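(* Consider the Wasserstein distributionally robust problem described in the context, under the regularity assumption stated there, and let $\rho\ge0$. Whenever $\hat{\mathbb P}\neq\mathbb Q(\infty)$, the lower bound $$\underline J(\rho)=\max_{\mathbb Q\in\widehat{\mathcal B}(\hat{\mathbb P})\cap\mathbb B_\rho(\hat{\mathbb P})}\ \inf_{\boldsymbol x\in\mathcal X(\Xi)}\ \mathbb E_{\mathbb Q}[\ell(\boldsymbol x,\tilde{\boldsymbol\xi})]$$ admits the reformulation $$\underline J(\rho)=\min_{\boldsymbol x\in\mathcal X(\Xi)}\mathbb E_{\widehat{\mathbb Q}(\rho)}[\ell(\boldsymbol x,\tilde{\boldsymbol\xi})]\qquad\text{with}\qquad\widehat{\mathbb Q}(\rho)=\mu(\rho)\,\hat{\mathbb P}+(1-\mu(\rho))\,\mathbb Q(\infty),$$ where $\mu(\rho)=\big[1-\rho/W(\hat{\mathbb P},\mathbb Q(\infty))\big]_+$. In the degenerate case $\hat{\mathbb P}=\mathbb Q(\infty)$, the dual shrinkage path $\widehat{\mathcal B}(\hat{\mathbb P})$ collapses to $\{\hat{\mathbb P}\}$ and the same reformulation holds with $\widehat{\mathbb Q}(\rho)=\hat{\mathbb P}$ for every $\rho\ge0$.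
   Context: Setting. $\mathcal X\subseteq\mathbb R^n$ is closed convex; $\Xi\subseteq\mathbb R^k$ is non-empty, closed and convex; the real-valued loss $\ell:\mathcal X\times\Xi\to\mathbb R$ is closed (lower semicontinuous) convex in $\boldsymbol x$ for every $\boldsymbol\xi\in\Xi$ and upper semicontinuous in $\boldsymbol\xi$ for every $\boldsymbol x\in\mathcal X$; $g_m(\cdot,\boldsymbol\xi)$, $m\in[M]$, are closed convex for every $\boldsymbol\xi$, and $\gamma_m\in\mathbb R$. The feasible set (for every radius) is $\mathcal X(\Xi)=\{\boldsymbol x\in\mathcal X: g_m(\boldsymbol x,\boldsymbol\xi)\le\gamma_m\ \forall\boldsymbol\xi\in\Xi,\ \forall m\in[M]\}$, assumed non-empty. $\hat{\mathbb P}=\frac1N\sum_{i=1}^N\delta_{\hat{\boldsymbol\xi}_i}$ with $\hat{\boldsymbol\xi}_i\in\Xi$. $d$ is a lower semicontinuous metric on $\Xi$, $W(\mathbb Q,\hat{\mathbb P})=\inf_{\pi\in\Pi(\mathbb Q,\hat{\mathbb P})}\int d(\boldsymbol\xi,\boldsymbol\xi')\,\pi(\mathrm d\boldsymbol\xi,\mathrm d\boldsymbol\xi')$ is the type-1 Wasserstein distance ($\Pi$ = couplings), $\mathcal P(\Xi)$ is the set of probability measures on $\Xi$, and $\mathbb B_\rho(\hat{\mathbb P})=\{\mathbb Q\in\mathcal P(\Xi):W(\mathbb Q,\hat{\mathbb P})\le\rho\}$. $\boldsymbol x(0)$ is a fixed optimal solution of the SAA problem $\min_{\boldsymbol x\in\mathcal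 X(\Xi)}\mathbb E_{\hat{\mathbb P}}[\ell(\boldsymbol x,\tilde{\boldsymbol\xi})]$ and $\boldsymbol x(\infty)$ a fixed optimal solution of the RO problem $\min_{\boldsymbol x\in\mathcal X(\Xi)}\sup_{\boldsymbol\xi\in\Xi}\ell(\boldsymbol x,\boldsymbol\xi)$; both are assumed to attain finite optimal values. Regularity assumption. (i) $\boldsymbol x\mapsto\mathbb E_{\hat{\mathbb P}}[\ell(\boldsymbol x,\tilde{\boldsymbol\xi})]$ is coercive on $\mathcal X$ (all its sublevel sets on $\mathcal X$ are bounded). (ii) There exist a neighborhood $\mathcal U$ of $\boldsymbol x(\infty)$ and a compact set $\mathcal K\subseteq\Xi$ such that $\sup_{\boldsymbol\xi\in\Xi}\ell(\boldsymbol x,\boldsymbol\xi)=\max_{\boldsymbol\xi\in\mathcal K}\ell(\boldsymbol x,\boldsymbol\xi)$ for all $\boldsymbol x\in\mathcal U\cap\mathcal X$. RO distribution and dual shrinkage path. $\mathbb Q(\infty)$ is a fixed, finitely supported element of $\arg\max_{\mathbb Q\in\mathcal P(\Xi)}\inf_{\boldsymbol x\in\mathcal X(\Xi)}\mathbb E_{\mathbb Q}[\ell(\boldsymbol x,\tilde{\boldsymbol\xi})]$ (under the regularity assumption such a maximizer exists). The dual shrinkage path is $\widehat{\mathcal B}(\hat{\mathbb P})=\{(1-\lambda)\hat{\mathbb P}+\lambda\mathbb Q(\infty):\lambda\in[0,1]\}$. $[\cdot]_+=\max\{\cdot,0\}$. *)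

(* Defs.v *)
(* MathComp / MathComp-Analysis. *)
From HB Require Import structures.
From mathcomp Require Import all_boot all_order all_algebra.
From mathcomp Require Import all_classical all_reals all_analysis.

Set Implicit Arguments.
Unset Strict Implicit.
Unset Printing Implicit Defensive.

Import Order.TTheory GRing.Theory Num.Theory.
Import numFieldNormedType.Exports.

Local Open Scope classical_set_scope.
Local Open Scope ring_scope.

Section optimization.
Context {R : realType} {T : Type}.
Local Open Scope ereal_scope.
Implicit Types (A : set T) (f : T -> \bar R).

Definition argmin A f : set T := [set a | A a /\ forall b, A b -> f a <= f b].

Definition argmax A f : set T := [set a | A a /\ forall b, A b -> f b <= f a].

(* [is_min A f v] reads [v = min_(a in A) f a]; it asserts that the minimum is
   attained. Likewise for [is_max]. *)
Definition is_min A f (v : \bar R) := exists2 a, argmin A f a & f a = v.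

Definition is_max A f (v : \bar R) := exists2 a, argmax A f a & f a = v.

End optimization.

Section regularity_of_functions.
Context {R : realType} {n : nat}.
Implicit Types (A : set 'rV[R]_n) (f : 'rV[R]_n -> \bar R).

(* The topology of [subspace A] makes every point outside [A] isolated, so these
   notions only depend on the restriction of [f] to [A]. *)
Definition lsc_on A f := lower_semicontinuous (f : subspace A -> \bar R).

Definition usc_on A f := lsc_on A (fun x => - f x)%E.

(* For extended-real-valued functions, convexity means convexity of the epigraph,
   which avoids any convention on [+oo - oo]. *)
Definition epigraph_on A f : set ('rV[R]_n * R^o)%type :=
  [set p | A p.1 /\ (f p.1 <= (p.2 : R)%:E)%E].

Definition closed_convex_on A f := lsc_on A f /\ convex_set (epigraph_on A f).

End regularity_of_functions.

(* R^k with its Borel sigma-algebra. *)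
Notation borelRV R k := (g_sigma_algebraType (@open 'rV[R]_k)).

Section measures.
Context {R : realType} {k : nat}.
Local Notation T := (borelRV R k).
Local Open Scope ereal_scope.
Implicit Types (P Q : probability T R) (Xi : set T).

(* Equality of Borel measures. Leibniz equality would also compare the values of
   the underlying set functions on non-measurable sets. *)
Definition eq_meas P Q := forall A : set T, measurable A -> P A = Q A.

(* Probability measures on [Xi] are identified with the Borel probability
   measures on R^k giving mass 1 to the closed set [Xi]. *)
Definition prob_on Xi : set (probability T R) := [set Q | Q Xi = 1].

Definition finitely_supported Q := exists2 S : set T, finite_set S & Q S = 1.

(* [N_gt0] is an argument so that the canonical probability structure below can
   be found. *)
Definition empirical (N : nat) (N_gt0 : (0 < N)%N) (xihat : 'I_N -> T)
    (A : set T) : \bar R :=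
  (N%:R^-1 : R)%:E * \sum_(i < N) \d_(xihat i) A.

Section empirical_probability.
Variables (N : nat) (N_gt0 : (0 < N)%N) (xihat : 'I_N -> T).
Local Notation emp := (empirical N_gt0 xihat).

Let dirac_seq (i : nat) : {measure set T -> \bar R} :=
  \d_(oapp xihat point (insub i)).

Let empE : emp = mscale ((N%:R^-1)%:nng)%R (msum dirac_seq N) :> (set T -> \bar R).
Proof.
apply/funext => A; rewrite /empirical /mscale /msum/=; congr (_ * _).
by apply: eq_bigr => i _; rewrite /dirac_seq valK.
Qed.

Let emp0 : emp set0 = 0.
Proof. by rewrite empE measure0. Qed.

Let emp_ge0 A : 0 <= emp A.
Proof. by rewrite empE measure_ge0. Qed.

Let emp_sigma_additive : semi_sigma_additive emp.
Proof. by rewrite empE; exact: measure_semi_sigma_additive. Qed.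

HB.instance Definition _ := isMeasure.Build _ _ _ emp
  emp0 emp_ge0 emp_sigma_additive.

Let emp_setT : emp setT = 1.
Proof.
rewrite /empirical (eq_bigr (fun=> 1%:E)); last by move=> i _; rewrite diracT.
rewrite sumEFin big_const_ord iter_addr_0 -EFinM mulVf//.
by rewrite pnatr_eq0 -lt0n.
Qed.

HB.instance Definition _ := Measure_isProbability.Build _ _ _ emp emp_setT.

End empirical_probability.

Definition mixture (t : {i01 R}) P Q : set T -> \bar R :=
  measure_add (mscale (t%:num%:nng)%R P) (mscale ((1 - t%:num)%:nng)%R Q).

Section mixture_probability.
Variables (t : {i01 R}) (P Q : probability T R).

HB.instance Definition _ := Measure.on (mixture t P Q).

Let mixture_setT : mixture t P Q setT = 1.
Proof.
rewrite /mixture measure_addE /= /mscale /=.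
by rewrite !probability_setT !mule1 -EFinD addrC subrK.
Qed.

HB.instance Definition _ :=
  Measure_isProbability.Build _ _ _ (mixture t P Q) mixture_setT.

End mixture_probability.

End measures.

Section wasserstein_distance.
Context {R : realType} {k : nat}.
Local Notation T := (borelRV R k).
Local Open Scope ereal_scope.
Variables (Xi : set 'rV[R]_k) (d : 'rV[R]_k -> 'rV[R]_k -> R).
Implicit Types (P Q : probability T R).

Record metric_on : Prop := MetricOn {
  metric_ge0 : forall x y, Xi x -> Xi y -> (0 <= d x y)%R ;
  metric_eq0 : forall x y, Xi x -> Xi y -> d x y = 0%R <-> x = y ;
  metric_sym : forall x y, Xi x -> Xi y -> d x y = d y x ;
  metric_triangle : forall x y z, Xi x -> Xi y -> Xi z ->
    (d x z <= d x y + d y z)%R }.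

Definition lsc_metric_on : Prop :=
  metric_on /\
  lower_semicontinuous
    (fun z : subspace (Xi `*` Xi) => (d z.1 z.2)%:E).

Definition couplings P Q : set (probability (T * T)%type R) :=
  [set pi | forall A : set T, measurable A ->
     pi (A `*` setT) = P A /\ pi (setT `*` A) = Q A].

Definition wasserstein P Q : \bar R :=
  ereal_inf [set \int[pi]_(z in Xi `*` Xi) (d z.1 z.2)%:E
            | pi in couplings P Q].

Definition wasserstein_ball (rho : R) P : set (probability T R) :=
  [set Q | prob_on Xi Q /\ wasserstein Q P <= rho%:E].

Lemma wasserstein_ge0 P Q : lsc_metric_on -> 0 <= wasserstein P Q.
Proof.
case=> -[d0 _ _ _] _; apply: le_ereal_inf_tmp => _ [pi _ <-].
by apply: integral_ge0 => z [z1 z2]; rewrite lee_fin; exact: d0.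
Qed.

Definition mu_shrinkage (rho : R) P Q : R :=
  Num.max (1 - rho / fine (wasserstein P Q))%R 0%R.

Lemma mu_shrinkage_ge0 rho P Q : (0 <= mu_shrinkage rho P Q)%R.
Proof. by rewrite /mu_shrinkage le_max lexx orbT. Qed.

Lemma mu_shrinkage_le1 rho P Q :
  lsc_metric_on -> (0 <= rho)%R -> (mu_shrinkage rho P Q <= 1)%R.
Proof.
move=> dm rho0; rewrite /mu_shrinkage ge_max ler01 andbT gerBl.
by rewrite divr_ge0// fine_ge0// wasserstein_ge0.
Qed.

(* [mu_shrinkage] bundled with the proof that it is in [0, 1]. *)
Definition mu_i01 (dm : lsc_metric_on) rho (rho0 : (0 <= rho)%R) P Q : {i01 R} :=
  Itv01 (mu_shrinkage_ge0 rho P Q) (mu_shrinkage_le1 P Q dm rho0).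

(* The segment from [P] to [Q] in the space of Borel probability measures. *)
Definition dual_path P Q : set (probability T R) :=
  [set S | exists lambda : {i01 R}, eq_meas S (mixture lambda Q P)].

End wasserstein_distance.

Section robust_problem.
Context {R : realType} {n k M : nat}.
Local Notation T := (borelRV R k).
Local Open Scope ereal_scope.
Variables (X : set 'rV[R]_n) (Xi : set 'rV[R]_k).
Variable (ell : 'rV[R]_n -> 'rV[R]_k -> R).

Definition feasible (g : 'I_M -> 'rV[R]_n -> 'rV[R]_k -> \bar R)
    (gamma : 'I_M -> R) : set 'rV[R]_n :=
  [set x | X x /\ forall (m : 'I_M) xi, Xi xi -> g m x xi <= (gamma m)%:E].

(* For [Q] in [prob_on Xi] this is E_Q[ell(x, xi)]; only the values of [ell x] on
   [Xi] matter. If the positive and negative parts both have infinite integral,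
   the value is -oo. *)
Definition expected_loss (Q : probability T R) (x : 'rV[R]_n) : \bar R :=
  \int[Q]_(xi in Xi) (ell x xi)%:E.

Definition worst_loss (x : 'rV[R]_n) : \bar R :=
  ereal_sup [set (ell x xi)%:E | xi in Xi].

Definition inf_loss (F : set 'rV[R]_n) (Q : probability T R) : \bar R :=
  ereal_inf [set expected_loss Q x | x in F].

Definition coercive_on (A : set 'rV[R]_n) (f : 'rV[R]_n -> \bar R) :=
  forall a : R, bounded_set [set x | A x /\ f x <= a%:E].

Definition locally_compact_worst_case (x0 : 'rV[R]_n) :=
  exists (U : set 'rV[R]_n) (K : set 'rV[R]_k),
    [/\ nbhs x0 U, compact K, K `<=` Xi &
        forall x, U x -> X x ->
          is_max K (fun xi => (ell x xi)%:E) (worst_loss x)].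

Definition lower_bound (d : 'rV[R]_k -> 'rV[R]_k -> R) (F : set 'rV[R]_n)
    (P Q : probability T R) (rho : R) : \bar R :=
  ereal_sup [set inf_loss F S
            | S in dual_path P Q `&` wasserstein_ball Xi d rho P].

End robust_problem.

(* Main.v *)
(* Along the segment from Phat to Qinf, the value inf_x E_Q[ell(x, .)] is a concave
   function of the parameter lambda (an infimum of affine functions) that is
   maximal at Qinf, hence it is nondecreasing in lambda. On the other hand
   W((1 - lambda) Phat + lambda Qinf, Phat) = lambda W(Phat, Qinf): convexity of W
   gives "<=", and also W(Qinf, Q_lambda) <= (1 - lambda) W(Qinf, Phat), so that the
   triangle inequality gives ">=". The best lambda within the ball is therefore
   min(1, rho / W) = 1 - mu(rho).
   The infimum at that measure is attained: for mu > 0 because the mean loss is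
   lower semicontinuous and coercive on the feasible set; for mu = 0 because
   x(infinity) attains it, by the minimax inequality
   sup_xi ell(x(infinity), xi) <= inf_x E_Qinf[ell(x, .)]. The latter follows
   from a finite theorem of the alternative for convex functions, applied to Phat
   and to the finitely many scenarios obtained by covering a sublevel set of the
   coercive function E_Phat[ell(x, .)]. All the measures involved being finitely
   supported, couplings are finite transport plans. *)
Require Import Defs.
From HB Require Import structures.
From mathcomp Require Import all_boot all_order all_algebra finmap.
From mathcomp Require Import all_classical all_reals all_analysis.
From mathcomp Require Import measurable_realfun ring lra.

Set Implicit Arguments.
Unset Strict Implicit.
Unset Printing Implicit Defensive.

Import Order.TTheory GRing.Theory Num.Theory.
Import numFieldNormedType.Exports.

Local Open Scope classical_set_scope.
Local Open Scope ring_scope.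

(** * Finite optimal transport *)

Section finite_transport.
Context {R : realType} {I : finType}.
Variable d : I -> I -> R.
Implicit Types (p q r : I -> R) (c : I -> I -> R).

Definition weights p := (forall i, 0 <= p i) /\ \sum_i p i = 1.

Definition plan p q : set (I -> I -> R) := [set c |
  [/\ forall i j, 0 <= c i j, forall i, \sum_j c i j = p i &
      forall j, \sum_i c i j = q j]].

Definition plan_cost c : R := \sum_i \sum_j c i j * d i j.

Definition transport p q : R := inf [set plan_cost c | c in plan p q].

Hypothesis d_ge0 : forall i j, 0 <= d i j.

Lemma plan_cost_ge0 p q c : plan p q c -> 0 <= plan_cost c.
Proof.
by move=> [c0 _ _]; apply: sumr_ge0 => i _; apply: sumr_ge0 => j _; rewrite mulr_ge0.
Qed.

Lemma plan_cost_lbound p q : has_lbound [set plan_cost c | c in plan p q].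
Proof. by exists 0 => _ [c cpq <-]; exact: plan_cost_ge0 cpq. Qed.

(** The independent plan has the right marginals. Nonemptiness matters because the real [inf] is
    only meaningful for nonempty sets bounded below. *)
Lemma plan_cost_nonempty p q : weights p -> weights q ->
  [set plan_cost c | c in plan p q] !=set0.
Proof.
move=> [p0 p1] [q0 q1]; apply: image_nonempty.
exists (fun i j => p i * q j); split=> [i j|i|j]; first by rewrite mulr_ge0.
- by rewrite -mulr_sumr q1 mulr1.
- by rewrite -mulr_suml p1 mul1r.
Qed.

Lemma transport_le p q c : plan p q c -> transport p q <= plan_cost c.
Proof.
by move=> cpq; apply: ge_inf; [exact: plan_cost_lbound|exists c].
Qed.

Lemma transport_ge0 p q : weights p -> weights q -> 0 <= transport p q.
Proof.
move=> wp wq; apply: lb_le_inf; first exact: plan_cost_nonempty.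
by move=> _ [c cpq <-]; exact: plan_cost_ge0 cpq.
Qed.

(** Near-optimal plans suffice below, so attainment of the infimum is never an issue. *)
Lemma transport_approx p q e : weights p -> weights q -> 0 < e ->
  exists2 c, plan p q c & plan_cost c < transport p q + e.
Proof.
move=> wp wq e0.
have [_ [c cpq <-] cle] := @inf_adherent _ [set plan_cost c | c in plan p q] _ e0
  (conj (plan_cost_nonempty wp wq) (@plan_cost_lbound p q)).
by exists c.
Qed.

(** Mixing two near-optimal plans gives a plan between the mixtures, and [plan_cost] is linear in
    the plan. *)
Lemma transport_convex p p' q q' t : 0 <= t <= 1 ->
  weights p -> weights p' -> weights q -> weights q' ->
  transport (fun i => t * p i + (1 - t) * p' i)
            (fun i => t * q i + (1 - t) * q' i) <=
  t * transport p q + (1 - t) * transport p' q'.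
Proof.
move=> /andP[t0 t1] wp wp' wq wq'; apply/ler_addgt0Pr => e e0.
have [c [c0 cp cq] ce] := transport_approx wp wq e0.
have [c' [c0' cp' cq'] ce'] := transport_approx wp' wq' e0.
pose b i j := t * c i j + (1 - t) * c' i j.
have : plan (fun i => t * p i + (1 - t) * p' i)
            (fun i => t * q i + (1 - t) * q' i) b.
  split=> [i j|i|j]; rewrite /b.
  - by rewrite addr_ge0// mulr_ge0// subr_ge0.
  - by rewrite big_split/= -!mulr_sumr cp cp'.
  - by rewrite big_split/= -!mulr_sumr cq cq'.
move=> /transport_le /le_trans; apply.
have -> : plan_cost b = t * plan_cost c + (1 - t) * plan_cost c'.
  rewrite /plan_cost !mulr_sumr -big_split; apply: eq_bigr => i _.
  rewrite !mulr_sumr -big_split; apply: eq_bigr => j _.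
  by rewrite /b /=; ring.
by move: (plan_cost c) (plan_cost c') ce ce' => u v; nra.
Qed.

Hypothesis d_eq0 : forall i j, d i j = 0 <-> i = j.
Hypothesis d_sym : forall i j, d i j = d j i.
Hypothesis d_triangle : forall i j k, d i k <= d i j + d j k.

(** The diagonal plan moves nothing and costs nothing. *)
Lemma transport_refl p : weights p -> transport p p = 0.
Proof.
move=> wp; have [p0 p1] := wp.
apply/eqP; rewrite eq_le transport_ge0// andbT.
have -> : 0 = plan_cost (fun i j => (i == j)%:R * p i).
  rewrite /plan_cost big1// => i _; rewrite big1// => j _.
  case: eqP => [->|_]; last by rewrite !mul0r.
  by have /d_eq0 -> : j = j by []; rewrite mulr0.
apply: transport_le; split=> [i j|i|j]; first by rewrite mulr_ge0.
- rewrite (bigD1 i)//= eqxx mul1r big1 ?addr0// => j.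
  by rewrite eq_sym => /negbTE ->; rewrite mul0r.
- by rewrite (bigD1 j)//= eqxx mul1r big1 ?addr0// => i /negbTE ->; rewrite mul0r.
Qed.

Lemma transport_sym p q : transport p q = transport q p.
Proof.
rewrite /transport; congr inf; apply/seteqP.
have H p' q' : [set plan_cost c | c in plan p' q'] `<=`
               [set plan_cost c | c in plan q' p'].
  move=> _ [c [c0 cp cq] <-]; exists (fun i j => c j i) => //.
  rewrite /plan_cost exchange_big; apply: eq_bigr => i _; apply: eq_bigr => j _.
  by rewrite d_sym.
by split; exact: H.
Qed.

(* The glued plan is [a i j * b j k / q j] summed over j; where [q j = 0], the
   row and column of j vanish, so that the junk value [0^-1 = 0] is harmless. *)
Lemma transport_triangle p q r : weights p -> weights q -> weights r ->
  transport p r <= transport p q + transport q r.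
Proof.
move=> wp wq wr; apply/ler_addgt0Pr => e e0.
have e20 : 0 < e / 2 by rewrite divr_gt0.
have [a [a0 ap aq] ae] := transport_approx wp wq e20.
have [b [b0 bq br] be] := transport_approx wq wr e20.
have aq0 i j : a i j / q j * q j = a i j.
  have [qj0|qj0] := eqVneq (q j) 0; last by rewrite divfK.
  rewrite qj0 mulr0; apply/esym/eqP; rewrite eq_le a0 andbT.
  by rewrite -qj0 -aq (bigD1 i)//= lerDl sumr_ge0.
have bq0 j k : b j k / q j * q j = b j k.
  have [qj0|qj0] := eqVneq (q j) 0; last by rewrite divfK.
  rewrite qj0 mulr0; apply/esym/eqP; rewrite eq_le b0 andbT.
  by rewrite -qj0 -bq (bigD1 k)//= lerDl sumr_ge0.
have sa i j : \sum_k a i j * b j k / q j = a i j.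
  by rewrite -mulr_suml -mulr_sumr bq mulrAC aq0.
have sb j k : \sum_i a i j * b j k / q j = b j k.
  by rewrite -mulr_suml -mulr_suml aq -mulrA mulrC bq0.
have g0 i j k : 0 <= a i j * b j k / q j.
  by rewrite !mulr_ge0// invr_ge0; case: wq.
pose c i k := \sum_j a i j * b j k / q j.
have : plan p r c.
  split=> [i k|i|k]; first exact: sumr_ge0.
  - by rewrite exchange_big/= -ap; apply: eq_bigr => j _.
  - by rewrite exchange_big/= -br; apply: eq_bigr => j _.
move=> /transport_le /le_trans; apply.
suff H : plan_cost c <= plan_cost a + plan_cost b by lra.
(* The triangle inequality for [d] is applied under the glued weights; in each half, the index
   absent from the distance is then summed out. *)
apply: (@le_trans _ _ (\sum_i \sum_k \sum_j
    (a i j * b j k / q j * d i j + a i j * b j k / q j * d j k))).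
  apply: ler_sum => i _; apply: ler_sum => k _; rewrite /c mulr_suml.
  by apply: ler_sum => j _; rewrite -mulrDr ler_wpM2l.
rewrite le_eqVlt; apply/orP; left; apply/eqP.
under eq_bigr do under eq_bigr do rewrite big_split.
under eq_bigr do rewrite big_split.
rewrite big_split/=; congr (_ + _); rewrite /plan_cost.
- apply: eq_bigr => i _; rewrite exchange_big/=; apply: eq_bigr => j _.
  by rewrite -mulr_suml sa.
- rewrite exchange_big/= [RHS]exchange_big/=; apply: eq_bigr => k _.
  rewrite exchange_big/=; apply: eq_bigr => j _.
  by rewrite -mulr_suml sb.
Qed.

(** Finitely many off-diagonal distances have a positive minimum; the default [1] keeps it positive
    when there are no two distinct indices. *)
Lemma separated : exists2 m, 0 < m & forall i j, i != j -> m <= d i j.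
Proof.
exists (\big[Num.min/1]_(x : I * I | x.1 != x.2) d x.1 x.2).
  elim/big_ind: _ => [//|u v u0 v0|[i j]/= ij]; first by rewrite lt_min u0.
  rewrite lt_neqAle d_ge0 andbT eq_sym; apply: contra ij => /eqP /d_eq0 ->//.
by move=> i j ij; rewrite (bigD1 (i, j))//= ge_min lexx.
Qed.

(** Mass leaving [i] travels at least [m], so a plan of cost below [m * e] moves less than [e] away
    from [i]; what stays at [i] is bounded by [q i]. *)
Lemma transport_eq0_le p q : weights p -> weights q -> transport p q = 0 ->
  forall i, p i <= q i.
Proof.
move=> wp wq W0 i; have [m m0 dm] := separated.
apply/ler_addgt0Pr => e e0.
have [c [c0 cp cq] ce] := transport_approx wp wq (mulr_gt0 m0 e0).
rewrite W0 add0r in ce; rewrite -cp -cq (bigD1 i)//=.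
apply: lerD; first by rewrite (bigD1 i)//= lerDl sumr_ge0.
rewrite -(ler_pM2l m0); apply: le_trans (ltW ce).
rewrite /plan_cost [leRHS](bigD1 i)//= -[leLHS]addr0; apply: lerD; last first.
  by apply: sumr_ge0 => j _; apply: sumr_ge0 => k _; rewrite mulr_ge0.
rewrite mulr_sumr [leRHS](bigD1 i)//= -[leLHS]add0r.
apply: lerD; first by rewrite mulr_ge0.
by apply: ler_sum => j ji; rewrite mulrC ler_wpM2l// dm// eq_sym.
Qed.

Lemma transport_eq0 p q : weights p -> weights q -> transport p q = 0 -> p = q.
Proof.
move=> wp wq W0; apply/funext => i; apply/le_anti/andP; split.
  exact: transport_eq0_le.
by apply: transport_eq0_le => //; rewrite transport_sym.
Qed.

(* Convexity gives the upper bound; it also bounds the cost between [q] and the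
   mixture, so the triangle inequality through the mixture gives the lower one. *)
Lemma transport_segment p q t : 0 <= t <= 1 -> weights p -> weights q ->
  transport (fun i => t * q i + (1 - t) * p i) p = t * transport q p.
Proof.
move=> t01 wp wq; have /andP[t0 t1] := t01.
set m := (fun i => _).
have wm : weights m.
  case: wp wq => p0 p1 [q0 q1]; split=> [i|]; rewrite /m.
    by rewrite addr_ge0// mulr_ge0// subr_ge0.
  by rewrite big_split/= -!mulr_sumr p1 q1 !mulr1 addrC subrK.
have mixid r : r = (fun i => t * r i + (1 - t) * r i).
  by apply/funext => i; ring.
have up : transport m p <= t * transport q p.
  have := transport_convex t01 wq wp wp wp.
  by rewrite -mixid (transport_refl wp) mulr0 addr0.
have up' : transport q m <= (1 - t) * transport q p.
  have := transport_convex t01 wq wq wq wp.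
  by rewrite -mixid (transport_refl wq) mulr0 add0r.
have tri := transport_triangle wq wm wp.
by apply/eqP; rewrite eq_le up/=; lra.
Qed.

End finite_transport.

(** * Finitely supported measures *)

Section finitely_supported_measures.
Context {dT : measure_display} {T : measurableType dT} {R : realType}.
Context {I : finType}.
Variable z : I -> T.
Local Open Scope ereal_scope.
Import HBNNSimple.
Implicit Types mu : probability T R.

Definition concentrated mu := mu (~` range z) = 0.

Definition atom_weight mu (i : I) : R := fine (mu [set z i]).

Hypothesis z_inj : injective z.
Hypothesis z_measurable : forall i, measurable [set z i].

Lemma range_bigsetU : range z = \big[setU/set0]_(i <- enum I) [set z i].
Proof.
apply/seteqP; split=> [_ [i _ <-]|x].
  by rewrite -bigcup_seq; exists i => //=; rewrite mem_enum.
by rewrite -bigcup_seq => -[i _ ->]; exists i.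
Qed.

Lemma measurable_atoms : measurable (range z).
Proof. by rewrite range_bigsetU; exact: bigsetU_measurable. Qed.

Lemma atom_weightE mu i : (atom_weight mu i)%:E = mu [set z i].
Proof. by rewrite fineK// fin_num_measure. Qed.

(** The complement of the atoms is negligible, and on each singleton the integrand is constant. *)
Lemma integral_atoms_measurable mu (f : T -> R) : concentrated mu ->
  measurable_fun setT f -> (forall x, (0 <= f x)%R) ->
  \int[mu]_x (f x)%:E = (\sum_i f (z i) * atom_weight mu i)%:E.
Proof.
move=> cmu mf f0.
have mf' : measurable_fun setT (fun x => (f x)%:E) by exact/measurable_EFinP.
rewrite (ge0_negligible_integral _ _ _ _ cmu)//; last 2 first.
  - by apply: measurableC; exact: measurable_atoms.
  - by move=> x _; rewrite lee_fin.
rewrite setTD setCK range_bigsetU ge0_integral_bigsetU//; last 4 first.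
  - exact: enum_uniq.
  - by move=> i j _ _ [x [-> /z_inj]].
  - exact: measurable_funTS.
  - by move=> x _; rewrite lee_fin.
rewrite -sumEFin big_enum/=; apply: eq_bigr => i _.
rewrite (@eq_integral _ _ _ _ _ (cst (f (z i))%:E)); last first.
  by move=> x; rewrite inE/= => ->.
by rewrite integral_cst// EFinM atom_weightE.
Qed.

(* Simple functions below f only see f at the atoms, so that f need not be
   measurable. *)
Lemma ge0_integral_atoms mu (f : T -> R) : concentrated mu ->
  (forall x, (0 <= f x)%R) ->
  \int[mu]_x (f x)%:E = (\sum_i f (z i) * atom_weight mu i)%:E.
Proof.
move=> cmu f0; apply/eqP; rewrite eq_le; apply/andP; split.
  rewrite ge0_integralTE => [|x]; last by rewrite lee_fin.
  apply: ge_ereal_sup => _ [h hf <-].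
  have -> : sintegral mu h = \int[mu]_x (h x)%:E.
    by rewrite integral_nnsfun// patch_setT.
  rewrite integral_atoms_measurable//.
  rewrite lee_fin; apply: ler_sum => i _; rewrite ler_wpM2r//.
    by rewrite fine_ge0.
  by have := hf (z i); rewrite lee_fin.
(* [g] equals [f] at the atoms and [0] elsewhere: a measurable minorant of the nonnegative [f] with
   the same finite sum. *)
pose g x := (\sum_i f (z i) * \1_[set z i] x)%R.
have gz i : g (z i) = f (z i).
  rewrite /g (bigD1 i)//= indicE mem_set// mulr1 big1 ?addr0// => j ji.
  rewrite indicE memNset ?mulr0//= => /z_inj ij.
  by rewrite ij eqxx in ji.
have g0 x : (0 <= g x)%R by apply: sumr_ge0 => i _; rewrite mulr_ge0.
have mg : measurable_fun setT g.
  apply: measurable_sum => i; apply: measurable_funM => //.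
have -> : (\sum_i f (z i) * atom_weight mu i)%:E = \int[mu]_x (g x)%:E.
  by rewrite integral_atoms_measurable//; under [in RHS]eq_bigr do rewrite gz.
rewrite !ge0_integralTE; try by move=> x; rewrite lee_fin.
apply: ereal_sup_le => _ [h hg <-]; exists h => // x.
apply: (le_trans (hg x)); rewrite lee_fin.
have [[i _ <-]|nx] := pselect (range z x); first by rewrite gz.
rewrite /g big1// => i _; rewrite indicE memNset ?mulr0//= => xz.
by apply: nx; exists i.
Qed.

(** The positive and negative parts both integrate to finite sums, so their difference is well
    defined. Restricting the integrand to [D] avoids any measurability condition on [D]. *)
Lemma integral_atoms mu (D : set T) (f : T -> R) : concentrated mu ->
  (forall i, D (z i)) ->
  \int[mu]_(x in D) (f x)%:E = (\sum_i f (z i) * atom_weight mu i)%:E.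
Proof.
move=> cmu Dz; rewrite integral_mkcond.
have -> : ((fun x => (f x)%:E) \_ D) = (fun x => ((f \_ D) x)%:E).
  by apply/funext => x; rewrite /patch; case: ifP.
have Df i : (f \_ D)%R (z i) = f (z i) by rewrite patchE mem_set.
rewrite integralE.
rewrite (@eq_integral _ _ _ _ _ (fun x => (Num.max ((f \_ D) x) 0)%:E)); last first.
  by move=> x _; rewrite funeposE EFin_max.
rewrite [X in _ - X](@eq_integral _ _ _ _ _
  (fun x => (Num.max (- (f \_ D) x) 0)%:E)); last first.
  by move=> x _; rewrite funenegE EFin_max.
rewrite !ge0_integral_atoms//; try by move=> x; rewrite le_max lexx orbT.
rewrite -EFinB -sumrB; congr EFin; apply: eq_bigr => i _.
rewrite Df -mulrBl; congr (_ * _)%R.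
have /orP[h|h] := le_total 0%R (f (z i)).
  by rewrite (max_l h) max_r ?subr0// oppr_le0.
by rewrite (max_r h) max_l ?oppr_ge0// sub0r opprK.
Qed.

Lemma measure_atoms mu (A : set T) : concentrated mu -> measurable A ->
  mu A = (\sum_i \1_A (z i) * atom_weight mu i)%:E.
Proof.
move=> cmu mA; rewrite -[LHS](_ : \int[mu]_x (\1_A x)%:E = _).
  exact: integral_atoms.
by rewrite integral_indic// setIT.
Qed.

Lemma atom_weight_weights mu : concentrated mu -> weights (atom_weight mu).
Proof.
move=> cmu; split=> [i|]; first by rewrite fine_ge0.
have := measure_atoms cmu measurableT; rewrite probability_setT => /eqP.
rewrite eqe => /eqP ->; apply: eq_bigr => i _.
by rewrite indicE in_setT mul1r.
Qed.

Lemma concentrated_mono mu (A : set T) : measurable A -> mu A = 1 ->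
  A `<=` range z -> concentrated mu.
Proof.
move=> mA A1 Az; apply/eqP; rewrite eq_le measure_ge0 andbT.
have <- : mu (~` A) = 0 by rewrite probability_setC// A1 subee.
apply: le_measure; rewrite ?inE; [|exact: measurableC|exact: subsetC].
by apply: measurableC; exact: measurable_atoms.
Qed.

Lemma probability_of_weights (w : I -> R) : weights w ->
  exists2 mu : probability T R, concentrated mu & atom_weight mu = w.
Proof.
move=> [w0 w1].
have [nu nuE] : exists nu : {measure set T -> \bar R},
    forall A, nu A = (\sum_i w i * \1_A (z i))%:E.
  elim: (index_enum I) => [|i s [nu nuE]].
    by exists mzero => A; rewrite big_nil.
  exists (measure_add (mscale (NngNum (w0 i)) (\d_(z i))) nu) => A.
  by rewrite [LHS]measure_addE nuE big_cons.
have nuT : nu setT = 1.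
  by rewrite nuE -w1; congr EFin; apply: eq_bigr => i _; rewrite indicE in_setT mulr1.
have [i0 _|I0] := pickP (@predT I); last first.
  by move: w1; rewrite big1 => [/esym/eqP|i]; [rewrite oner_eq0|have := I0 i].
(* [nu] already has mass [1]: normalization leaves it unchanged and only supplies the probability
   structure, with [\d_(z i0)] as its fallback value. *)
pose mu : probability T R := mnormalize nu (\d_(z i0)).
have muE A : mu A = (\sum_i w i * \1_A (z i))%:E.
  by rewrite -nuE /mu /= /mnormalize nuT/= onee_eq0/= invr1 mule1.
exists mu.
  rewrite /concentrated muE big1// => i _; rewrite indicE memNset ?mulr0//=.
  by apply; exists i.
apply/funext => i; rewrite /atom_weight muE/= (bigD1 i)//= big1 => [|j ji].
  by rewrite addr0 indicE mem_set// mulr1.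
rewrite indicE memNset ?mulr0//= => /z_inj ij.
by rewrite ij eqxx in ji.
Qed.

End finitely_supported_measures.

(** * Wasserstein distance between measures on common atoms as finite transport *)

Section discrete_wasserstein.
Context {R : realType} {k : nat} {I : finType}.
Local Notation T := (borelRV R k).
Variables (Xi : set 'rV[R]_k) (d : 'rV[R]_k -> 'rV[R]_k -> R) (z : I -> T).
Hypothesis z_inj : injective z.
Hypothesis Xi_z : forall i, Xi (z i).
Hypothesis d_metric : lsc_metric_on Xi d.
Implicit Types P Q : probability T R.

Let zz (ij : I * I) : T * T := (z ij.1, z ij.2).
Let dz i j := d (z i) (z j).

Lemma measurable_borel_set1 (x : T) : measurable [set x].
Proof.
rewrite -(setCK [set x]); apply: measurableC; apply: sub_sigma_algebra.
apply: closed_openC.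
exact: accessible_closed_set1 (@hausdorff_accessible _ (@norm_hausdorff _ 'rV[R]_k)) _.
Qed.

Let mzz ij : measurable [set zz ij].
Proof.
have -> : [set zz ij] = [set z ij.1] `*` [set z ij.2].
  by apply/seteqP; split=> [_ -> //|[a b] [/= -> ->]].
by apply: measurableX; exact: measurable_borel_set1.
Qed.

Let zz_inj : injective zz.
Proof. by move=> [i j] [i' j'] [/z_inj -> /z_inj ->]. Qed.

Let mz := measurable_borel_set1.

(** A pair off the grid of atoms has a coordinate that is not an atom, hence lies in one of two
    strips that are null by the marginal conditions. *)
Lemma coupling_concentrated P Q pi : concentrated z P -> concentrated z Q ->
  couplings P Q pi -> concentrated zz pi.
Proof.
move=> cP cQ cpi; apply/eqP; rewrite eq_le measure_ge0 andbT.
have mC : measurable (~` range z).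
  by apply: measurableC; exact: measurable_atoms.
have [pP _] := cpi _ mC; have [_ pQ] := cpi _ mC.
rewrite /concentrated in cP cQ; rewrite cP in pP; rewrite cQ in pQ.
apply: (@le_trans _ _ (pi ((~` range z `*` setT) `|` (setT `*` ~` range z)))).
  apply: le_measure; rewrite ?inE.
  - by apply: measurableC; exact: measurable_atoms.
  - by apply: measurableU; exact: measurableX.
  - move=> [a b] nab.
    have [[i _ ia]|na] := pselect (range z a); last by left.
    have [[j _ jb]|nb] := pselect (range z b); last by right.
    by case: nab; exists (i, j); rewrite // /zz/= ia jb.
have mL : measurable (~` range z `*` [set: T]) by exact: measurableX.
have mR : measurable ([set: T] `*` ~` range z) by exact: measurableX.
apply: (le_trans (measureU2 pi mL mR)).
by rewrite -[leRHS]adde0; apply: leeD; rewrite le_eqVlt; apply/orP; left; apply/eqP.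
Qed.

(** Couplings live on the grid of pairs of atoms, so they correspond to finite plans of equal cost,
    and both infima range over the same values. *)
Lemma wasserstein_transport P Q : concentrated z P -> concentrated z Q ->
  wasserstein Xi d P Q =
  (transport dz (atom_weight z P) (atom_weight z Q))%:E.
Proof.
move=> cP cQ.
have wP := atom_weight_weights z_inj (fun i => mz (z i)) cP.
have wQ := atom_weight_weights z_inj (fun i => mz (z i)) cQ.
have dz0 i j : 0 <= dz i j by case: d_metric => -[d0 _ _ _] _; exact: d0.
rewrite /transport -ereal_inf_EFin; [|exact: plan_cost_lbound|exact: plan_cost_nonempty].
have cost pi : concentrated zz pi ->
    (\int[pi]_(u in Xi `*` Xi) (d u.1 u.2)%:E =
     (plan_cost dz (fun i j => atom_weight zz pi (i, j)))%:E)%E.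
  move=> cpi.
  rewrite (@integral_atoms _ _ _ _ zz zz_inj mzz pi _ (fun u => d u.1 u.2))//;
    last by move=> ij; split; exact: Xi_z.
  congr EFin; rewrite /plan_cost pair_big/=.
  by apply: eq_bigr => -[i j] _; rewrite mulrC.
have margin pi (cpi : concentrated zz pi) A : measurable A ->
    pi A = (\sum_i \sum_j \1_A (z i, z j) * atom_weight zz pi (i, j))%:E.
  move=> mA; rewrite (measure_atoms zz_inj mzz cpi mA) pair_big/=.
  by congr EFin; apply: eq_bigr => -[i j] _.
congr ereal_inf; apply/seteqP; split.
  (* From coupling to plan: row and column sums are the masses of the strips over the single
     atoms. *)
  move=> _ [pi cpi <-]; have czz := coupling_concentrated cP cQ cpi.
  exists (plan_cost dz (fun i j => atom_weight zz pi (i, j))); last by rewrite cost.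
  exists (fun i j => atom_weight zz pi (i, j)) => //; split=> [i j|i|j].
  - by rewrite fine_ge0.
  - apply: EFin_inj; rewrite (atom_weightE (fun i => mz (z i))).
    apply: etrans (proj1 (cpi _ (mz (z i)))).
    rewrite margin//; last exact: measurableX.
    congr EFin; rewrite [RHS](bigD1 i)//= [X in _ + X]big1 ?addr0 => [|i' ii'].
      by apply: eq_bigr => j _; rewrite indicE mem_set ?mul1r.
    apply: big1 => j _; rewrite indicE memNset ?mul0r//= => -[/z_inj ie _].
    by rewrite ie eqxx in ii'.
  - apply: EFin_inj; rewrite (atom_weightE (fun i => mz (z i))).
    apply: etrans (proj2 (cpi _ (mz (z j)))).
    rewrite margin//; last exact: measurableX.
    congr EFin; apply: eq_bigr => i _.
    rewrite [RHS](bigD1 j)//= [X in _ + X]big1 ?addr0 => [|j' jj'].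
      by rewrite indicE mem_set ?mul1r.
    rewrite indicE memNset ?mul0r//= => -[_ /z_inj je].
    by rewrite je eqxx in jj'.
(* From plan to coupling: the entries of [c] serve as the weights of a measure on pairs of atoms. *)
move=> _ [_ [c [c0 cp cq] <-] <-].
have [pi cpi piE] : exists2 pi : probability (T * T)%type R,
    concentrated zz pi & atom_weight zz pi = (fun ij => c ij.1 ij.2).
  apply: probability_of_weights => //; split=> //.
  rewrite -(pair_big xpredT xpredT c)/=.
  by under eq_bigr do rewrite cp; case: wP.
exists pi; last by rewrite cost// piE.
move=> A mA; split.
  rewrite margin//; last exact: measurableX.
  rewrite (measure_atoms z_inj (fun i => mz (z i)) cP mA); congr EFin.
  apply: eq_bigr => i _; rewrite -cp mulr_sumr; apply: eq_bigr => j _.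
  rewrite piE/=; congr (_ * _); by rewrite !indicE in_setX in_setT andbT.
rewrite margin//; last exact: measurableX.
rewrite (measure_atoms z_inj (fun i => mz (z i)) cQ mA) exchange_big; congr EFin.
apply: eq_bigr => j _; rewrite -cq mulr_sumr; apply: eq_bigr => i _.
rewrite piE/=; congr (_ * _); by rewrite !indicE in_setX in_setT.
Qed.

End discrete_wasserstein.

(** * Convex functions and lower semicontinuity *)

Section convex_alternative.
Context {R : realType} {n : nat}.
Local Notation E := 'rV[R]_n.
Implicit Types (F : set E) (f h : E -> R).

Lemma convex_function_le F f x y t : convex_function F f -> F x -> F y ->
  0 <= t <= 1 -> f (t *: x + (1 - t) *: y) <= t * f x + (1 - t) * f y.
Proof.
move=> cf Fx Fy /andP[t0 t1]; have := cf (Itv01 t0 t1) x y; rewrite !inE.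
by move=> /(_ Fx Fy).
Qed.

Lemma convex_set_segment F x y t : convex_set F -> F x -> F y ->
  0 <= t <= 1 -> F (t *: x + (1 - t) *: y).
Proof.
move=> cF Fx Fy /andP[t0 t1]; have := cF x y (Itv01 t0 t1).
by rewrite !inE; apply.
Qed.

(* If [f x * h y > f y * h x], then a suitable point of the segment [x, y] makes
   both functions negative. *)
Lemma cross_le F f h x y : convex_set F ->
  convex_function F f -> convex_function F h ->
  (forall x, F x -> 0 <= f x \/ 0 <= h x) ->
  F x -> F y -> f x < 0 -> h y < 0 -> f x * h y <= f y * h x.
Proof.
move=> cF cf ch fh Fx Fy fx hy; rewrite leNgt; apply/negP => lt.
have hx : 0 <= h x by have [|//] := fh _ Fx; lra.
have fy : 0 <= f y by have [//|] := fh _ Fy; lra.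
have fyx : 0 < f y - f x by lra.
have hxy : 0 < h x - h y by lra.
(* With weight [t] on [x], the chord of [f] is negative for [t > u] and that of [h] for [t < v]; the
   inequality assumed for contradiction says exactly [u < v]. *)
pose u := f y / (f y - f x); pose v := (- h y) / (h x - h y).
pose t := (u + v) / 2.
have uv : u < v by rewrite /u /v ltr_pdivrMr// mulrAC ltr_pdivlMr//; nra.
have u0 : 0 <= u by rewrite /u divr_ge0// ltW.
have v1 : v <= 1 by rewrite /v ler_pdivrMr//; lra.
have t01 : 0 <= t <= 1 by rewrite /t; lra.
have ut : u < t by rewrite /t; lra.
have tv : t < v by rewrite /t; lra.
have fw := convex_function_le cf Fx Fy t01.
have hw := convex_function_le ch Fx Fy t01.
have := fh _ (convex_set_segment cF Fx Fy t01).
have Hf : t * f x + (1 - t) * f y < 0.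
  by move: ut; rewrite /u ltr_pdivrMr//; lra.
have Hh : t * h x + (1 - t) * h y < 0.
  by move: tv; rewrite /v ltr_pdivlMr//; lra.
by case; lra.
Qed.

(** By [cross_le], the ratios [- f a / h a] at points where [f] is negative lie below the ratios
    [f b / - h b] at points where [h] is negative. Their supremum [sup A] is a multiplier for [h]
    that makes [f + sup A * h] nonnegative. *)
Lemma two_convex_alternative F f h : convex_set F ->
  convex_function F f -> convex_function F h ->
  (forall x, F x -> 0 <= f x \/ 0 <= h x) ->
  exists2 t, 0 <= t <= 1 & forall x, F x -> 0 <= t * f x + (1 - t) * h x.
Proof.
move=> cF cf ch fh.
have [f0|/existsNP[x /not_implyP[Fx /negP]]] := pselect (forall x, F x -> 0 <= f x).
  by exists 1 => [|x Fx]; rewrite ?lexx ?ler01// subrr mul0r addr0 mul1r f0.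
rewrite -ltNge => fx.
have [h0|/existsNP[y /not_implyP[Fy /negP]]] := pselect (forall x, F x -> 0 <= h x).
  by exists 0 => [|w Fw]; rewrite ?lexx ?ler01// subr0 mul0r add0r mul1r h0.
rewrite -ltNge => hy.
have cross a b := @cross_le F f h a b cF cf ch fh.
(* Strict positivity, so that the ratios defining [A] have nonzero denominators. *)
have pos a : F a -> f a < 0 -> 0 < h a.
  move=> Fa fa; have := cross _ _ Fa Fy fa hy.
  have := fh _ Fy; have := fh _ Fa; move=> [|ha]; first lra.
  by move=> [fy|]; [nra|lra].
pose A := [set - f a / h a | a in F `&` [set a | f a < 0]].
have Aub b : F b -> h b < 0 -> ubound A (f b / - h b).
  move=> Fb hb _ [a [Fa fa] <-]; rewrite ler_pdivrMr; last exact: pos.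
  by rewrite mulrAC ler_pdivlMr ?oppr_gt0//; have := cross _ _ Fa Fb fa hb; lra.
have A0 : A !=set0 by exists (- f x / h x), x.
have hsA : has_sup A by split=> //; exists (f y / - h y); exact: Aub.
have s0 : 0 <= sup A.
  apply: (@le_trans _ _ (- f x / h x)).
    by rewrite divr_ge0//; [lra|exact/ltW/pos].
  by apply: ub_le_sup; [case: hsA|exists x].
have s1 : 0 < 1 + sup A by lra.
have sE : 1 - (1 + sup A)^-1 = sup A / (1 + sup A) by field; lra.
(* The multipliers [1] and [sup A], normalized to sum to [1]. *)
exists (1 + sup A)^-1.
  by rewrite invr_ge0 (ltW s1) invf_le1//; lra.
move=> w Fw; rewrite sE.
have -> : (1 + sup A)^-1 * f w + sup A / (1 + sup A) * h w =
  (f w + sup A * h w) / (1 + sup A) by field; lra.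
apply: divr_ge0; last exact: ltW.
have [fw|fw] := ltP (f w) 0.
  have hw := pos _ Fw fw.
  have : - f w / h w <= sup A by apply: ub_le_sup; [by case: hsA|exists w].
  by rewrite ler_pdivrMr//; lra.
have [hw|hw] := ltP (h w) 0; last by rewrite addr_ge0// mulr_ge0.
have : sup A <= f w / - h w by apply: ge_sup => //; exact: Aub.
by rewrite ler_pdivlMr ?oppr_gt0//; lra.
Qed.

(* Induction on the list: restrict to the convex set where the first member is
   below [c], then combine it with the function obtained there. *)
Lemma convex_alternative (C : set (E -> R)) F (s : seq (E -> R)) c :
  C !=set0 -> (forall f h (t : R), C f -> C h -> 0 <= t <= 1 ->
    C (fun x => t * f x + (1 - t) * h x)) ->
  (forall f, C f -> convex_function F f) ->
  convex_set F -> {in s, forall f, C f} ->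
  (forall x, F x -> exists2 f, f \in s & c <= f x) ->
  exists2 f, C f & forall x, F x -> c <= f x.
Proof.
move=> [f0 Cf0] Cconv.
elim: s F => [|f s ih] F Ccvx cF sC cov.
  (* A covering by no function forces [F] to be empty, so any member of [C] serves. *)
  by exists f0 => // x /cov[].
have Cf : C f by apply: sC; rewrite mem_head.
pose F' := F `&` [set x | f x < c].
have cF' : convex_set F'.
  move=> x y t; rewrite !inE => -[Fx fx] [Fy fy].
  have t01 : 0 <= t%:num <= 1 by rewrite ge0 le1.
  split; first exact: (convex_set_segment cF Fx Fy t01).
  apply: le_lt_trans (convex_function_le (Ccvx _ Cf) Fx Fy t01) _.
  move: fx fy t01 => /=; move: (f x) (f y) (t%:num) => u v w uc vc /andP[w0 w1].
  by have [uv|uv] := leP u v; nra.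
have [h Ch hF'] : exists2 h, C h & forall x, F' x -> c <= h x.
  apply: ih => //.
  - move=> h Ch t x y; rewrite !inE => -[Fx _] [Fy _].
    by apply: (Ccvx _ Ch); rewrite inE.
  - by move=> h hs; apply: sC; rewrite in_cons hs orbT.
  - move=> x [Fx fx]; have [h] := cov _ Fx.
    rewrite in_cons => /orP[/eqP ->|hs ch]; last by exists h.
    by rewrite leNgt fx.
have sub k : C k -> convex_function F (fun x => k x - c).
  move=> Ck t x y xF yF; have := Ccvx _ Ck t _ _ xF yF.
  rewrite !convRE /unstable.onem /=; set w := t%:num; set a := k _; lra.
have [x Fx|t t01 H] := two_convex_alternative cF (sub _ Cf) (sub _ Ch).
  have [fx|fx] := ltP (f x) c; last by left; rewrite subr_ge0.
  by right; rewrite subr_ge0 hF'.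
exists (fun x => t * f x + (1 - t) * h x); first exact: Cconv.
by move=> x Fx; have := H _ Fx; lra.
Qed.

End convex_alternative.

(** * Lower semicontinuity relative to a set, finite subcovers and minimizers *)

Section lower_semicontinuity.
Context {R : realType}.

Lemma lower_semicontinuousD (T : topologicalType) (f h : T -> R) :
  lower_semicontinuous (fun x => (f x)%:E) ->
  lower_semicontinuous (fun x => (h x)%:E) ->
  lower_semicontinuous (fun x => (f x + h x)%:E).
Proof.
move=> lf lh x a; rewrite lte_fin => ax.
pose e := (f x + h x - a) / 2.
have e0 : 0 < e by rewrite divr_gt0// subr_gt0.
have [|U Ux fU] := lf x (f x - e); first by rewrite lte_fin; lra.
have [|V Vx hV] := lh x (h x - e); first by rewrite lte_fin; lra.
exists (U `&` V); first exact: filterI.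
move=> y [/fU + /hV]; rewrite !lte_fin /e; lra.
Qed.

Lemma lower_semicontinuousZ (T : topologicalType) (f : T -> R) c : 0 <= c ->
  lower_semicontinuous (fun x => (f x)%:E) ->
  lower_semicontinuous (fun x => (c * f x)%:E).
Proof.
rewrite le_eqVlt => /orP[/eqP <- _ x a|c0 lf x a].
  rewrite mul0r => a0; exists setT => [|y _]; first exact: filterT.
  by rewrite mul0r.
rewrite lte_fin -ltr_pdivrMl// => ax.
have [U Ux fU] := lf x _ ax; exists U => // y /fU.
by rewrite !lte_fin -ltr_pdivrMl.
Qed.

Lemma lower_semicontinuous_sum (T : topologicalType) (J : Type) (s : seq J)
    (f : J -> T -> R) :
  (forall i, lower_semicontinuous (fun x => (f i x)%:E)) ->
  lower_semicontinuous (fun x => (\sum_(i <- s) f i x)%:E).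
Proof.
move=> lf; elim: s => [x a|i s ih].
  rewrite big_nil => a0; exists setT => [|y _]; first exact: filterT.
  by rewrite big_nil.
under [X in lower_semicontinuous X]eq_fun do rewrite big_cons.
exact: lower_semicontinuousD.
Qed.

Context {n : nat}.
Local Notation E := 'rV[R]_n.
Implicit Types (X B : set E).

(** Trades relative openness in [X] for an open set of the ambient space, where compactness
    applies. *)
Lemma lsc_on_open X (f : E -> \bar R) a : lsc_on X f ->
  exists2 V : set E, open V & forall x, X x -> V x <-> (a%:E < f x)%E.
Proof.
move=> lf; have /open_subspaceP[V oV VX] := (lower_semicontinuousP _).1 lf a.
exists V => // x Xx; split=> [Vx|fx].
  have : (V `&` X) x by [].
  by rewrite VX => -[].
have : ([set x | (a%:E < f x)%E] `&` X) x by [].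
by rewrite -VX => -[].
Qed.

Lemma closed_sublevel X (f : E -> \bar R) a : closed X -> lsc_on X f ->
  closed [set x | X x /\ (f x <= a%:E)%E].
Proof.
move=> cX lf; have [V oV VE] := lsc_on_open a lf.
suff -> : [set x | X x /\ (f x <= a%:E)%E] = X `&` ~` V.
  by apply: closedI => //; exact: open_closedC.
apply/seteqP; split=> x [Xx] /=; first by rewrite leNgt => /negP fx; split=> // /VE; auto.
by move=> nV; split=> //; rewrite leNgt; apply/negP => /VE; auto.
Qed.

(** Strict superlevel sets are relatively open. This serves both to extract finitely many scenarios
    and to find minimizers. *)
Lemma lsc_finite_subcover X B (J : choiceType) (D : set J)
    (f : J -> E -> \bar R) (c : J -> R) :
  compact B -> B `<=` X -> (forall i, D i -> lsc_on X (f i)) ->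
  (forall x, B x -> exists2 i, D i & ((c i)%:E < f i x)%E) ->
  exists2 s : seq J, {in s, forall i, D i} &
    forall x, B x -> exists2 i, i \in s & ((c i)%:E < f i x)%E.
Proof.
move=> cB BX lf cov.
have /choice[V VP] : forall i, exists V : set E, D i ->
    open V /\ forall x, X x -> V x <-> ((c i)%:E < f i x)%E.
  (* Indices outside [D] carry no condition and get the dummy value [set0]. *)
  move=> i; have [Di|nDi] := pselect (D i); last by exists set0.
  by have [V oV VE] := lsc_on_open (c i) (lf _ Di); exists V.
rewrite compact_cover in cB.
have [i Di|x Bx|s sD sB] := cB J D V; first by have [] := VP _ Di.
  have [i Di ci] := cov _ Bx; exists i => //.
  by have [_ ->] := VP _ Di; last exact: BX.
exists (enum_fset s) => [i /sD|x Bx]; first by rewrite inE.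
have [i si Vi] := sB _ Bx; exists i => //.
have Di : D i by have := sD i si; rewrite inE.
by have [_ /(_ _ (BX _ Bx)) <-] := VP _ Di.
Qed.

Lemma seq_argmin (J : eqType) (f : J -> R) (s : seq J) : s != [::] ->
  exists2 i, i \in s & {in s, forall j, f i <= f j}.
Proof.
elim: s => [//|i s ih] _; have [->|/ih[j js jmin]] := eqVneq s [::].
  by exists i => [|j]; rewrite !inE// => /eqP ->.
have [ij|/ltW ji] := leP (f i) (f j).
  exists i => [|l]; rewrite in_cons ?eqxx// => /orP[/eqP ->//|ls].
  by rewrite (le_trans ij)// jmin.
exists j => [|l]; rewrite in_cons ?js ?orbT// => /orP[/eqP ->//|ls].
exact: jmin.
Qed.

(** Without a minimizer, the sets where [f] exceeds [f y], for [y] in [B], would cover [B]; but in a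
    finite subcover, the index with the least value is itself uncovered. *)
Lemma lsc_min X B (f : E -> R) : compact B -> B !=set0 -> B `<=` X ->
  lsc_on X (fun x => (f x)%:E) ->
  exists2 x, B x & forall y, B y -> f x <= f y.
Proof.
move=> cB [x0 Bx0] BX lf; apply: contrapT => nmin.
have [//||s sB cov] := @lsc_finite_subcover X B E B (fun _ x => (f x)%:E) f cB BX.
  move=> x Bx; apply: contrapT => ny; apply: nmin; exists x => // y By.
  by rewrite leNgt; apply/negP => yx; apply: ny; exists y.
have s0 : s != [::] by have [i] := cov _ Bx0; case: s {sB cov}.
have [y ys ymin] := seq_argmin f s0.
have [i si] := cov _ (sB _ ys).
by rewrite lte_fin ltNge ymin.
Qed.

End lower_semicontinuity.

(** * Mean losses and the Wasserstein distance on the path *)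

Section finitely_supported_losses.
Context {R : realType} {n k : nat}.
Local Notation T := (borelRV R k).
Variables (X : set 'rV[R]_n) (Xi : set 'rV[R]_k).
Variable (ell : 'rV[R]_n -> 'rV[R]_k -> R).
Implicit Types P Q S : probability T R.

(** The atoms must lie in [Xi], the only place where the hypotheses on [d] and [ell] apply. *)
Definition finitely_supported_in Q :=
  exists A : set T, [/\ finite_set A, A `<=` Xi & Q A = 1%E].

(** For measures in [finitely_supported_in], [fine] loses nothing, the expected loss being a finite
    sum. *)
Definition mean_loss Q x : R := fine (expected_loss Xi ell Q x).

Lemma measurable_finite_set (A : set T) : finite_set A -> measurable A.
Proof.
move=> fA; rewrite -(image_id A) -bigcup_imset1.
by apply: fin_bigcup_measurable => // x _; exact: measurable_borel_set1.
Qed.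

Lemma measurable_closed (A : set 'rV[R]_k) : closed A -> measurable (A : set T).
Proof.
move=> cA; rewrite -(setCK A); apply: measurableC; apply: sub_sigma_algebra.
exact: closed_openC.
Qed.

Lemma mixtureE (t : {i01 R}) P Q (A : set T) :
  mixture t P Q A = (t%:num%:E * P A + (1 - t%:num)%:E * Q A)%E.
Proof. by rewrite /mixture measure_addE. Qed.

(** Indexing by the union of the two supports turns both measures into weight vectors over one
    finite type. *)
Lemma common_atoms P Q :
  finitely_supported_in P -> finitely_supported_in Q ->
  exists (I : finType) (z : I -> T),
    [/\ injective z, forall i, Xi (z i), concentrated z P & concentrated z Q].
Proof.
move=> [A [fA AXi A1]] [B [fB BXi B1]].
have /finite_fsetP[Z ZE] : finite_set (A `|` B) by rewrite finite_setU.
have rZ : range (val : Z -> T) = A `|` B.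
  rewrite ZE; apply/seteqP; split=> [_ [z _ <-]|x xZ]; first exact: valP.
  by exists [` xZ]%fset.
have mz (i : Z) : measurable [set val i] by exact: measurable_borel_set1.
exists Z, val; split.
- exact: val_inj.
- move=> i; have : (A `|` B) (val i) by rewrite -rZ; exists i.
  by case=> [/AXi|/BXi].
- by apply: (concentrated_mono mz (measurable_finite_set fA)) => //; rewrite rZ.
- by apply: (concentrated_mono mz (measurable_finite_set fB)) => //; rewrite rZ.
Qed.

Lemma eq_meas_expected_loss P Q x : eq_meas P Q ->
  expected_loss Xi ell P x = expected_loss Xi ell Q x.
Proof. by move=> PQ; apply: eq_measure_integral => A mA _; exact: PQ. Qed.

Lemma expected_loss_atoms (I : finType) (z : I -> T) Q x : injective z ->
  (forall i, Xi (z i)) -> concentrated z Q ->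
  expected_loss Xi ell Q x = (\sum_i ell x (z i) * atom_weight z Q i)%:E.
Proof.
move=> z_inj Xiz cQ; rewrite /expected_loss.
exact: (integral_atoms z_inj (fun i => measurable_borel_set1 (z i))).
Qed.

Lemma mean_loss_atoms (I : finType) (z : I -> T) Q x : injective z ->
  (forall i, Xi (z i)) -> concentrated z Q ->
  mean_loss Q x = \sum_i ell x (z i) * atom_weight z Q i.
Proof. by move=> *; rewrite /mean_loss (@expected_loss_atoms I z). Qed.

Lemma expected_lossE Q x : finitely_supported_in Q ->
  expected_loss Xi ell Q x = (mean_loss Q x)%:E.
Proof.
move=> fQ; have [I [z [z_inj Xiz cQ _]]] := common_atoms fQ fQ.
by rewrite /mean_loss (expected_loss_atoms _ z_inj).
Qed.

Lemma atom_weight_mixture (I : finType) (z : I -> T) (t : {i01 R}) P Q i :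
  atom_weight z (mixture t P Q) i =
  t%:num * atom_weight z P i + (1 - t%:num) * atom_weight z Q i.
Proof.
have mz j : measurable [set z j] by exact: measurable_borel_set1.
by apply: EFin_inj; rewrite EFinD !EFinM !atom_weightE// [LHS]mixtureE.
Qed.

Lemma concentrated_mixture (I : finType) (z : I -> T) (t : {i01 R}) P Q :
  concentrated z P -> concentrated z Q -> concentrated z (mixture t P Q).
Proof.
move=> cP cQ; rewrite /concentrated [LHS]mixtureE.
by rewrite (cP : P _ = _) (cQ : Q _ = _) !mule0 adde0.
Qed.

Lemma mean_loss_mixture (t : {i01 R}) P Q x :
  finitely_supported_in P -> finitely_supported_in Q ->
  mean_loss (mixture t P Q) x =
  t%:num * mean_loss P x + (1 - t%:num) * mean_loss Q x.
Proof.
move=> fP fQ; have [I [z [z_inj Xiz cP cQ]]] := common_atoms fP fQ.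
rewrite !(mean_loss_atoms _ z_inj)//; last exact: concentrated_mixture.
rewrite !mulr_sumr -big_split; apply: eq_bigr => i _ /=.
by rewrite atom_weight_mixture; ring.
Qed.

Lemma finitely_supported_mixture (t : {i01 R}) P Q :
  finitely_supported_in P -> finitely_supported_in Q ->
  finitely_supported_in (mixture t P Q).
Proof.
move=> [A [fA AXi A1]] [B [fB BXi B1]].
have mA := measurable_finite_set fA; have mB := measurable_finite_set fB.
have U1 S (C : set T) : measurable C -> C `<=` A `|` B -> S C = 1%E ->
    S (A `|` B) = 1%E.
  move=> mC CAB C1; apply/eqP; rewrite eq_le probability_le1; last exact: measurableU.
  by rewrite -C1; apply: le_measure; rewrite ?inE//; exact: measurableU.
exists (A `|` B); split; first by rewrite finite_setU.
  by move=> x [/AXi|/BXi].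
rewrite [LHS]mixtureE (U1 P _ mA)// (U1 Q _ mB)// !mule1 -EFinD.
by congr EFin; ring.
Qed.

Lemma finitely_supported_dirac (xi : T) : Xi xi ->
  finitely_supported_in (\d_xi : probability T R).
Proof.
move=> Xixi; exists [set xi]; split => //; first by move=> _ ->.
by rewrite /= diracE mem_set.
Qed.

Lemma mean_loss_dirac (xi : T) x : Xi xi ->
  mean_loss (\d_xi : probability T R) x = ell x xi.
Proof.
move=> Xixi.
have mz (i : unit) : measurable [set xi] by exact: measurable_borel_set1.
have u_inj : injective (fun _ : unit => xi) by move=> [] [].
have d1 : (\d_xi : probability T R) [set xi] = 1%E by rewrite /= diracE mem_set.
rewrite (mean_loss_atoms _ u_inj)//.
  rewrite (bigD1 tt)//= big1 ?addr0; last by case.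
  by rewrite /atom_weight [X in fine X]d1 mulr1.
by apply: (concentrated_mono mz (mz tt) d1) => _ ->; exists tt.
Qed.

Lemma finitely_supported_prob_on Q : closed Xi -> finitely_supported_in Q ->
  prob_on Xi Q.
Proof.
move=> cXi [A [fA AXi A1]]; have mXi := measurable_closed cXi.
apply/eqP; rewrite eq_le probability_le1//= -A1; apply: le_measure; rewrite ?inE//.
exact: measurable_finite_set.
Qed.

(** The support may have points outside [Xi], but these are null and can be cut off. *)
Lemma finitely_supported_inP Q : closed Xi -> finitely_supported Q ->
  prob_on Xi Q -> finitely_supported_in Q.
Proof.
move=> cXi [A fA A1] Q1; have mXi := measurable_closed cXi.
have mA := measurable_finite_set fA.
exists (A `&` Xi); split; [exact: finite_setIl|by move=> x []|].
have cA : Q (~` A) = 0%E by rewrite probability_setC// A1 subee.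
have cX : Q (~` Xi) = 0%E.
  by rewrite probability_setC// (_ : Q Xi = 1%E) ?subee.
have mAX : measurable (A `&` (Xi : set T)) by exact: measurableI.
have : Q (~` (A `&` Xi)) = 0%E.
  apply/eqP; rewrite eq_le measure_ge0 andbT setCI.
  apply: (le_trans (measureU2 Q (measurableC mA) (measurableC mXi))).
  by rewrite -[leRHS]adde0; apply: leeD; rewrite le_eqVlt; apply/orP; left; apply/eqP.
rewrite probability_setC// -(@fineK _ (Q _)) ?fin_num_measure// -EFinB => -[].
by move/subr0_eq => <-.
Qed.

Lemma mean_loss_convex Q : finitely_supported_in Q ->
  (forall xi, Xi xi -> convex_function X (ell ^~ xi)) ->
  convex_function X (mean_loss Q).
Proof.
move=> fQ cvx t x y xX yX.
have [I [z [z_inj Xiz cQ _]]] := common_atoms fQ fQ.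
rewrite !(mean_loss_atoms _ z_inj)// convRE !mulr_sumr -big_split/=.
apply: ler_sum => i _; have := cvx _ (Xiz i) t x y xX yX; rewrite convRE !mulrA.
rewrite -mulrDl => h; apply: ler_wpM2r => //; exact: fine_ge0.
Qed.

Lemma mean_loss_lsc Q : finitely_supported_in Q ->
  (forall xi, Xi xi -> lsc_on X (fun x => (ell x xi)%:E)) ->
  lsc_on X (fun x => (mean_loss Q x)%:E).
Proof.
move=> fQ lsc; have [I [z [z_inj Xiz cQ _]]] := common_atoms fQ fQ.
have -> : mean_loss Q = (fun x => \sum_i atom_weight z Q i * ell x (z i)).
  apply/funext => x; rewrite (mean_loss_atoms _ z_inj)//.
  by apply: eq_bigr => i _; rewrite mulrC.
apply: lower_semicontinuous_sum => i; apply: lower_semicontinuousZ.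
  exact: fine_ge0.
exact: lsc.
Qed.

(* Coercivity of the mean loss of P confines the covering argument to a compact
   sublevel set: where the mean loss of P exceeds V, the measure P itself does
   the job. *)
Lemma approximate_worst_case (F : set 'rV[R]_n) P V e : closed F -> convex_set F ->
  F `<=` X -> finitely_supported_in P ->
  (forall xi, Xi xi -> lsc_on X (fun x => (ell x xi)%:E)) ->
  (forall xi, Xi xi -> convex_function X (ell ^~ xi)) ->
  closed X -> coercive_on X (expected_loss Xi ell P) ->
  (forall x, F x -> (V%:E <= worst_loss Xi ell x)%E) -> 0 < e ->
  exists2 Q, finitely_supported_in Q & forall x, F x -> V - e <= mean_loss Q x.
Proof.
move=> cF cvF FX fP lsc cvx cX coer VF e0.
pose B := F `&` [set x | X x /\ ((mean_loss P x)%:E <= V%:E)%E].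
have cB : compact B.
  apply: bounded_closed_compact.
    apply: sub_boundedr (coer V) => S SV x [_ [Xx PV]]; apply: SV.
    by split=> //; rewrite expected_lossE.
  by apply: closedI => //; apply: closed_sublevel => //; exact: mean_loss_lsc.
have [|x Bx|s sXi cov] := @lsc_finite_subcover _ _ X B 'rV[R]_k Xi
    (fun xi x => (ell x xi)%:E) (fun=> V - e) cB _ lsc.
- by move=> x [/FX].
- have [_ [xi Xixi <-] ?] : exists2 y, [set (ell x xi)%:E | xi in Xi] y &
      ((V - e)%:E < y)%E.
    apply: ereal_sup_gt; apply: lt_le_trans (VF _ _); last by case: Bx.
    by rewrite lte_fin; lra.
  by exists xi.
(* Mean losses are stable under convex combinations through mixtures, so the convex alternative
   yields the mean loss of an actual measure. *)
pose C := [set mean_loss Q | Q in finitely_supported_in].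
have [|f h t [Q fQ <-] [Q' fQ' <-] /andP[t0 t1]||//||x Fx|_ [Q fQ <-] QV] :=
    @convex_alternative R n C F
    (mean_loss P :: [seq mean_loss (\d_(xi : T) : probability T R) | xi <- s]) (V - e).
- by exists (mean_loss P), P.
- exists (mixture (Itv01 t0 t1) Q Q'); first exact: finitely_supported_mixture.
  by apply/funext => x; rewrite mean_loss_mixture.
- move=> _ [Q fQ <-] t x y; rewrite !inE => Fx Fy.
  by apply: mean_loss_convex => //; rewrite inE; exact: FX.
- move=> f; rewrite in_cons => /orP[/eqP ->|/mapP[xi xis ->]]; first by exists P.
  by exists \d_(xi : T) => //; apply: finitely_supported_dirac; exact: sXi.
- have [PV|PV] := leP (mean_loss P x) V.
    have [|xi xis] := cov x; first by split=> //; split=> //; exact: FX.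
    rewrite lte_fin => Vx; exists (mean_loss (\d_(xi : T) : probability T R)).
      by rewrite in_cons; apply/orP; right; apply/mapP; exists xi.
    by rewrite mean_loss_dirac ?ltW//; exact: sXi.
  by exists (mean_loss P); rewrite ?mem_head//; lra.
by exists Q.
Qed.

End finitely_supported_losses.

(** * Finiteness, separation and linearity of the Wasserstein distance on a segment *)

Section wasserstein_on_segment.
Context {R : realType} {k : nat}.
Local Notation T := (borelRV R k).
Variables (Xi : set 'rV[R]_k) (d : 'rV[R]_k -> 'rV[R]_k -> R).
Hypothesis d_metric : lsc_metric_on Xi d.
Implicit Types P Q S : probability T R.

Lemma eq_meas_wasserstein P Q S : eq_meas P Q ->
  wasserstein Xi d P S = wasserstein Xi d Q S.
Proof.
move=> PQ; congr ereal_inf; congr image.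
apply/seteqP; split=> pi cpi A mA; first by rewrite -PQ//; exact: cpi.
by rewrite PQ//; exact: cpi.
Qed.

Lemma wasserstein_fin P Q :
  finitely_supported_in Xi P -> finitely_supported_in Xi Q ->
  wasserstein Xi d P Q \is a fin_num.
Proof.
move=> fP fQ; have [I [z [z_inj Xiz cP cQ]]] := common_atoms fP fQ.
by rewrite (wasserstein_transport z_inj Xiz d_metric cP cQ).
Qed.

Lemma wasserstein_eq0 P Q :
  finitely_supported_in Xi P -> finitely_supported_in Xi Q ->
  wasserstein Xi d P Q = 0%E -> eq_meas P Q.
Proof.
move=> fP fQ; have [I [z [z_inj Xiz cP cQ]]] := common_atoms fP fQ.
have mz i : measurable [set z i] by exact: measurable_borel_set1.
rewrite (wasserstein_transport z_inj Xiz d_metric cP cQ) => -[W0] A mA.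
rewrite (measure_atoms z_inj mz cP mA) (measure_atoms z_inj mz cQ mA).
case: d_metric => -[d0 deq dsym dtri] _.
congr EFin; apply: eq_bigr => i _; congr (_ * _).
have -> // : atom_weight z P = atom_weight z Q.
apply: transport_eq0 W0; try exact: atom_weight_weights.
- by move=> *; exact: d0.
- by move=> a b; split=> [/deq h|->]; [exact/z_inj/h|exact/deq].
- by move=> *; exact: dsym.
Qed.

Lemma wasserstein_segment (t : {i01 R}) P Q :
  finitely_supported_in Xi P -> finitely_supported_in Xi Q ->
  wasserstein Xi d (mixture t Q P) P = (t%:num%:E * wasserstein Xi d P Q)%E.
Proof.
move=> fP fQ; have [I [z [z_inj Xiz cP cQ]]] := common_atoms fP fQ.
have mz i : measurable [set z i] by exact: measurable_borel_set1.
rewrite !(wasserstein_transport z_inj Xiz d_metric)//; last exact: concentrated_mixture.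
case: d_metric => -[d0 deq dsym dtri] _.
have wP := atom_weight_weights z_inj mz cP.
have wQ := atom_weight_weights z_inj mz cQ.
rewrite (_ : atom_weight z (mixture t Q P) = (fun i =>
    t%:num * atom_weight z Q i + (1 - t%:num) * atom_weight z P i)); last first.
  by apply/funext => i; exact: atom_weight_mixture.
have t01 : 0 <= t%:num <= 1 by rewrite ge0 le1.
rewrite transport_segment//.
- by rewrite EFinM (@transport_sym _ _ _ _ (atom_weight z Q))// => *; exact: dsym.
- by move=> *; exact: d0.
- by move=> a b; split=> [/deq h|->]; [exact/z_inj/h|exact/deq].
- by move=> *; exact: dtri.
Qed.

End wasserstein_on_segment.

Section extremal_values.
Context {R : realType} {T : Type}.
Implicit Types (A : set T) (f : T -> \bar R).
Local Open Scope ereal_scope.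

Lemma argmax_ereal_sup A f a : argmax A f a -> f a = ereal_sup [set f x | x in A].
Proof.
move=> [Aa fa]; apply/eqP; rewrite eq_le; apply/andP; split.
  by apply: ereal_sup_ubound; exists a.
by apply: ge_ereal_sup => _ [b Ab <-]; exact: fa.
Qed.

Lemma argmin_ereal_inf A f a : argmin A f a -> f a = ereal_inf [set f x | x in A].
Proof.
move=> [Aa fa]; apply/eqP; rewrite eq_le; apply/andP; split.
  by apply: le_ereal_inf_tmp => _ [b Ab <-]; exact: fa.
by apply: ereal_inf_lbound; exists a.
Qed.

End extremal_values.

Section empirical_support.
Context {R : realType} {k : nat}.

Lemma finitely_supported_empirical (Xi : set 'rV[R]_k) N (N_gt0 : (0 < N)%N)
    (xihat : 'I_N -> borelRV R k) : (forall i, Xi (xihat i)) ->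
  finitely_supported_in Xi (empirical N_gt0 xihat).
Proof.
move=> Xixi; exists (range xihat); split.
- exact: finite_image.
- by move=> _ [i _ <-].
rewrite /= /empirical (eq_bigr (fun=> 1%E)) => [|i _]; last first.
  by rewrite diracE mem_set//; exists i.
rewrite sumEFin sumr_const card_ord -EFinM mulVf//.
by rewrite pnatr_eq0 -lt0n.
Qed.

End empirical_support.

(** * Closedness and convexity of the feasible set *)

Section feasible_set.
Context {R : realType} {n k M : nat}.
Variables (X : set 'rV[R]_n) (Xi : set 'rV[R]_k).
Variables (g : 'I_M -> 'rV[R]_n -> 'rV[R]_k -> \bar R) (gamma : 'I_M -> R).
Hypothesis g_closed_convex : forall m xi, Xi xi -> closed_convex_on X (g m ^~ xi).

Lemma closed_feasible : closed X -> closed (feasible X Xi g gamma).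
Proof.
move=> cX.
have -> : feasible X Xi g gamma = X `&`
    \bigcap_(mxi in [set mxi : 'I_M * 'rV[R]_k | Xi mxi.2])
    [set x | X x /\ (g mxi.1 x mxi.2 <= (gamma mxi.1)%:E)%E].
  apply/seteqP; split=> x [Xx gx]; split=> //.
    by move=> [m xi] /= Xixi; split=> //; exact: gx.
  by move=> m xi Xixi; have [] := gx (m, xi) Xixi.
apply: closedI => //; apply: closed_bigI => -[m xi] /= Xixi.
by apply: closed_sublevel => //; have [] := g_closed_convex m Xixi.
Qed.

Lemma convex_feasible : convex_set X -> convex_set (feasible X Xi g gamma).
Proof.
move=> cvX x y t; rewrite !inE => -[Xx gx] [Xy gy]; split.
  by have := cvX x y t; rewrite !inE; apply.
move=> m xi Xixi; have [_ cvg] := g_closed_convex m Xixi.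
(* Both points are taken in the epigraph at the same height [gamma m], which the combination
   keeps. *)
have := cvg (x, gamma m) (y, gamma m) t; rewrite !inE => h.
have [] := h (conj Xx (gx m xi Xixi)) (conj Xy (gy m xi Xixi)) => _ /=.
by rewrite -scalerDl /unstable.onem [t%:num + _]addrC subrK scale1r.
Qed.

End feasible_set.

(** * The optimal value along the segment *)

Section losses_along_the_path.
Context {R : realType} {n k : nat}.
Local Notation T := (borelRV R k).
Variables (Xi : set 'rV[R]_k) (ell : 'rV[R]_n -> 'rV[R]_k -> R).
Variable F : set 'rV[R]_n.
Implicit Types P Q S : probability T R.
Local Notation fs := (finitely_supported_in Xi).
Local Notation mean := (mean_loss Xi ell).

Lemma eq_meas_inf_loss P Q : eq_meas P Q ->
  inf_loss Xi ell F P = inf_loss Xi ell F Q.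
Proof.
move=> PQ; rewrite /inf_loss; congr (ereal_inf (image _ _)).
by apply/funext => x; exact: eq_meas_expected_loss.
Qed.

(** Reconciles two parametrizations: [mu_i01] weighs [Phat], whereas the path parameter weighs
    [Qinf]. *)
Lemma eq_meas_mixture_sym (s t : {i01 R}) P Q : s%:num + t%:num = 1 ->
  eq_meas (mixture s P Q) (mixture t Q P).
Proof.
move=> st A mA; rewrite [LHS]mixtureE [RHS]mixtureE addeC.
by congr (_%:E * _ + _%:E * _)%E; lra.
Qed.

(* The mean loss is affine along the path for every decision: if it decreases
   from s to t, then it is at least its value at Q there. *)
Lemma inf_loss_path_mono (s t : {i01 R}) P Q : fs P -> fs Q ->
  s%:num <= t%:num ->
  (inf_loss Xi ell F (mixture s Q P) <= inf_loss Xi ell F Q)%E ->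
  (inf_loss Xi ell F (mixture s Q P) <= inf_loss Xi ell F (mixture t Q P))%E.
Proof.
move=> fP fQ st sQ; apply: le_ereal_inf_tmp => _ [x Fx <-].
rewrite expected_lossE; last exact: finitely_supported_mixture.
have inf_le S : fs S -> (inf_loss Xi ell F S <= (mean S x)%:E)%E.
  by move=> fS; rewrite -expected_lossE//; apply: ereal_inf_lbound; exists x.
have [le|lt] := leP (mean (mixture s Q P) x) (mean (mixture t Q P) x).
  apply: (le_trans (inf_le _ (finitely_supported_mixture s fQ fP))).
  by rewrite lee_fin.
apply: (le_trans sQ); apply: (le_trans (inf_le _ fQ)); rewrite lee_fin.
have t1 : t%:num <= 1 by rewrite le1.
move: lt; rewrite !mean_loss_mixture//; move: (mean Q x) (mean P x) => q p.
by move: st t1; move: (s%:num) (t%:num) => u v; have [qp|/ltW pq] := leP q p; nra.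
Qed.

End losses_along_the_path.

Theorem theorem4 (R : realType) (n k M N : nat)
    (X : set 'rV[R]_n) (Xi : set 'rV[R]_k)
    (ell : 'rV[R]_n -> 'rV[R]_k -> R)
    (g : 'I_M -> 'rV[R]_n -> 'rV[R]_k -> \bar R) (gamma : 'I_M -> R)
    (d : 'rV[R]_k -> 'rV[R]_k -> R)
    (X_closed : closed X) (X_convex : convex_set X)
    (Xi_nonempty : Xi !=set0) (Xi_closed : closed Xi) (Xi_convex : convex_set Xi)
    (ell_lsc : forall xi, Xi xi -> lsc_on X (fun x => (ell x xi)%:E))
    (ell_convex : forall xi, Xi xi -> convex_function X (ell ^~ xi))
    (ell_usc : forall x, X x -> usc_on Xi (fun xi => (ell x xi)%:E))
    (g_closed_convex : forall m xi, Xi xi -> closed_convex_on X (g m ^~ xi))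
    (XXi_nonempty : feasible X Xi g gamma !=set0)
    (d_metric : lsc_metric_on Xi d)
    (N_gt0 : (0 < N)%N) (xihat : 'I_N -> borelRV R k)
    (xihat_Xi : forall i, Xi (xihat i))
    (x0 xinf : 'rV[R]_n) (Qinf : probability (borelRV R k) R)
    (Phat : probability (borelRV R k) R := empirical N_gt0 xihat)
    (XXi : set 'rV[R]_n := feasible X Xi g gamma)
    (x0_SAA : argmin XXi (expected_loss Xi ell Phat) x0)
    (x0_finite : expected_loss Xi ell Phat x0 \is a fin_num)
    (xinf_RO : argmin XXi (worst_loss Xi ell) xinf)
    (xinf_finite : worst_loss Xi ell xinf \is a fin_num)
    (SAA_coercive : coercive_on X (expected_loss Xi ell Phat))
    (RO_compact : locally_compact_worst_case X Xi ell xinf)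
    (Qinf_finite : finitely_supported Qinf)
    (Qinf_RO : argmax (prob_on Xi) (inf_loss Xi ell XXi) Qinf)
    (rho : R) (rho_ge0 : 0 <= rho) :
  let path := dual_path Phat Qinf in
  let J := lower_bound Xi ell d XXi Phat Qinf rho in
  let reformulation (Qhat : probability (borelRV R k) R) :=
    is_max (path `&` wasserstein_ball Xi d rho Phat) (inf_loss Xi ell XXi) J /\
    is_min XXi (expected_loss Xi ell Qhat) J in
  (~ eq_meas Phat Qinf ->
     reformulation (mixture (mu_i01 d_metric rho_ge0 Phat Qinf) Phat Qinf)) /\
  (eq_meas Phat Qinf ->
     path = [set S | eq_meas S Phat] /\ reformulation Phat).
Proof.
move=> path J reformulation.
have fP : finitely_supported_in Xi Phat by exact: finitely_supported_empirical.
have fQ : finitely_supported_in Xi Qinf.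
  by apply: finitely_supported_inP => //; case: Qinf_RO.
have FX : XXi `<=` X by move=> x [].
have cF : closed XXi by exact: closed_feasible.
have cvF : convex_set XXi by exact: convex_feasible.
have infQ S : finitely_supported_in Xi S ->
    (inf_loss Xi ell XXi S <= inf_loss Xi ell XXi Qinf)%E.
  by move=> fS; case: Qinf_RO => _; apply; exact: finitely_supported_prob_on.
(* A maximizer fixes the supremum [J] as its own infimum value, which any minimizer at that measure
   attains. *)
have refl Qhat :
    argmax (path `&` wasserstein_ball Xi d rho Phat) (inf_loss Xi ell XXi) Qhat ->
    (exists x, argmin XXi (expected_loss Xi ell Qhat) x) -> reformulation Qhat.
  move=> Qmax [x xmin]; have JE := argmax_ereal_sup Qmax.
  by split; [exists Qhat|exists x => //; rewrite (argmin_ereal_inf xmin)].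
split=> [PneQ|PeqQ]; last first.
  have pathE : path = [set S | eq_meas S Phat].
    apply/seteqP; split=> S /=.
      move=> [t St] A mA; rewrite St// [LHS]mixtureE -PeqQ// -ge0_muleDl ?lee_fin//.
      by rewrite -EFinD addrC subrK mul1e.
    move=> SP; exists 0%:i01 => A mA; rewrite SP// [RHS]mixtureE/=.
    by rewrite mul0e add0e subr0 mul1e.
  split=> //; apply: refl; last by exists x0.
  split=> [|S [+ _]]; last by rewrite pathE => /eq_meas_inf_loss ->.
  split; first by rewrite pathE.
  split; first exact: finitely_supported_prob_on.
  (* Writing [Phat] as a mixture of weight [0] makes the segment formula give distance [0] to
     itself. *)
  have mixP : eq_meas (mixture 0%:i01 Phat Phat) Phat.
    by move=> A mA; rewrite [LHS]mixtureE/= mul0e add0e subr0 mul1e.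
  rewrite -(eq_meas_wasserstein _ _ _ mixP) (wasserstein_segment d_metric)//.
  by rewrite (_ : (0%:i01)%:num = 0 :> R)// mul0e lee_fin.
set w := fine (wasserstein Xi d Phat Qinf).
have wE : wasserstein Xi d Phat Qinf = w%:E by rewrite fineK// wasserstein_fin.
(* Distinct measures are at positive distance, so that [rho / w] is a genuine quotient. *)
have w0 : 0 < w.
  rewrite lt_neqAle fine_ge0 ?wasserstein_ge0// andbT eq_sym.
  apply/eqP => w0; apply: PneQ; apply: (wasserstein_eq0 d_metric) => //.
  by rewrite wE w0.
set m := mu_i01 _ _ _ _.
have mE : m%:num = Num.max (1 - rho / w) 0 by [].
have m0 : 0 <= m%:num by rewrite ge0.
have m1 : m%:num <= 1 by rewrite le1.
have l0 : 0 <= 1 - m%:num by rewrite subr_ge0.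
have l1 : 1 - m%:num <= 1 by rewrite gerBl.
pose l : {i01 R} := Itv01 l0 l1.
have lE : l%:num = 1 - m%:num by [].
have QhatE : eq_meas (mixture m Phat Qinf) (mixture l Qinf Phat).
  by apply: eq_meas_mixture_sym; rewrite /= addrC subrK.
have fQhat := finitely_supported_mixture m fP fQ.
apply: refl.
  split.
    split; first by exists l.
    split; first exact: finitely_supported_prob_on.
    rewrite (eq_meas_wasserstein _ _ _ QhatE) (wasserstein_segment d_metric)//.
    rewrite wE -EFinM lee_fin -ler_pdivlMr// lE.
    have : 1 - rho / w <= m%:num by rewrite mE le_max lexx.
    by move=> ?; lra.
  (* A competitor in the ball has [t <= rho / w] and [t <= 1], hence [t <= l], and the value is
     monotone up to [l]. *)
  move=> S [[t St] [_]].
  rewrite (eq_meas_wasserstein _ _ _ St) (wasserstein_segment d_metric)//.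
  rewrite wE -EFinM lee_fin -ler_pdivlMr// => tw.
  rewrite (eq_meas_inf_loss _ _ _ St) (eq_meas_inf_loss _ _ _ QhatE).
  apply: inf_loss_path_mono => //; last first.
    exact/infQ/finitely_supported_mixture.
  have t1 : t%:num <= 1 by rewrite le1.
  by rewrite lE mE; case: (leP (1 - rho / w) 0) => _; lra.
have [mpos|] := ltP 0 m%:num; last first.
  move=> mneg; have {}m0 : m%:num = 0 by apply/le_anti; rewrite mneg.
  have QhatQ : eq_meas (mixture m Phat Qinf) Qinf.
    by move=> A mA; rewrite [LHS]mixtureE m0 mul0e add0e subr0 mul1e.
  have [Fxinf xinf_min] := xinf_RO.
  have worstE : worst_loss Xi ell xinf = (fine (worst_loss Xi ell xinf))%:E.
    by rewrite fineK.
  (* Any finitely supported measure whose mean loss nearly dominates the robust value is itself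
     beaten by [Qinf]; then [e] tends to [0]. *)
  have lower : (worst_loss Xi ell xinf <= inf_loss Xi ell XXi Qinf)%E.
    rewrite worstE; apply/lee_addgt0Pr => e e0; rewrite -leeBlDr// -EFinB.
    have [x Fx|Q fsQ Qe] := @approximate_worst_case _ _ _ X Xi ell XXi Phat
      (fine (worst_loss Xi ell xinf)) e cF cvF FX fP ell_lsc ell_convex X_closed
      SAA_coercive _ e0.
      by rewrite -worstE; exact: xinf_min.
    apply: le_trans (infQ _ fsQ); apply: le_ereal_inf_tmp => _ [x Fx <-].
    by rewrite expected_lossE// lee_fin; exact: Qe.
  (* An average over atoms in [Xi] is at most the worst case; with [lower], this makes [xinf]
     optimal for [Qinf]. *)
  have upper : (expected_loss Xi ell Qinf xinf <= worst_loss Xi ell xinf)%E.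
    have [I [z [z_inj Xiz cQ _]]] := common_atoms fQ fQ.
    rewrite (expected_loss_atoms _ _ z_inj)// worstE lee_fin.
    have [q0 q1] := atom_weight_weights z_inj (fun i => measurable_borel_set1 (z i)) cQ.
    rewrite -[leRHS]mulr1 -q1 mulr_sumr; apply: ler_sum => i _; apply: ler_wpM2r => //.
    by rewrite -lee_fin -worstE; apply: ereal_sup_ubound; exists (z i).
  exists xinf; split=> // x Fx.
  rewrite !(eq_meas_expected_loss _ _ _ QhatQ).
  apply: (le_trans upper); apply: (le_trans lower).
  by apply: ereal_inf_lbound; exists x.
(* The mean loss of Qinf is bounded below on the feasible set, hence the mean loss
   of the mixture inherits coercivity from that of Phat. *)
have [Fx0 x0_min] := x0_SAA.
(* The SAA value is the infimum at [Phat], which is at most the infimum at the maximizer [Qinf]. *)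
have Q_ge x : XXi x -> mean_loss Xi ell Phat x0 <= mean_loss Xi ell Qinf x.
  move=> Fx; rewrite -lee_fin -!expected_lossE//.
  rewrite (argmin_ereal_inf x0_SAA); apply: (le_trans (infQ _ fP)).
  by apply: ereal_inf_lbound; exists x.
(* Level [a] keeps [x0] in the sublevel set [B]. The bound [b] solves [m * b + (1 - m) * mean = a],
   with [mean] the SAA value, so [B] lies in the sublevel set of the mean loss of [Phat] at level
   [b]. *)
pose a := mean_loss Xi ell (mixture m Phat Qinf) x0.
pose b := (a - (1 - m%:num) * mean_loss Xi ell Phat x0) / m%:num.
have lscQ := mean_loss_lsc fQhat ell_lsc.
pose f := mean_loss Xi ell (mixture m Phat Qinf).
pose B := XXi `&` [set x | X x /\ ((f x)%:E <= a%:E)%E].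
have [|||y [Fy [Xy ya]] ymin] := @lsc_min _ _ X B f _ _ _ lscQ.
- apply: bounded_closed_compact; last by apply: closedI => //; exact: closed_sublevel.
  apply: sub_boundedr (SAA_coercive b) => S Sb x [Fx [Xx xa]]; apply: Sb.
  split=> //; rewrite expected_lossE// lee_fin ler_pdivlMr//.
  move: xa; rewrite lee_fin /f mean_loss_mixture//.
  by have := ler_wpM2l l0 (Q_ge _ Fx); lra.
- by exists x0; split=> //; split; first exact: FX.
- by move=> x [_ []].
exists y; split=> // x Fx; rewrite !expected_lossE// lee_fin.
(* Feasible points outside [B] have loss above [a], hence above the minimum over [B]. *)
have [xa|xa] := leP (mean_loss Xi ell (mixture m Phat Qinf) x) a.
  by apply: ymin; split=> //; split; [exact: FX|rewrite lee_fin].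
by apply: (le_trans _ (ltW xa)); rewrite -lee_fin.
Qed.
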